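(* Let $n\ge 1$, $\boldsymbol{m}=(m_1,\dots,m_n)\in\mathbb{N}_0^n$ and $\boldsymbol{t}_{\boldsymbol{m}}=(t_{m_1},\dots,t_{m_n})\in\mathbb{R}^n$. Let $\tau_{\boldsymbol{m}}(z;\boldsymbol{t}_{\boldsymbol{m}})$ and $P_{\boldsymbol{m};i}(z;\boldsymbol{t}_{\boldsymbol{m}})$, $i\in\mathbb{N}_0$, be the polynomials defined in the context, and set $T_{\boldsymbol{m}}(\boldsymbol{t}_{\boldsymbol{m}}):=\hat T(\tau_{\boldsymbol{m}}(z;\boldsymbol{t}_{\boldsymbol{m}}))$. Then $T_{\boldsymbol{m}}(\boldsymbol{t}_{\boldsymbol{m}})$ is an exceptional Legendre operator, and it satisfies $$T_{\boldsymbol{m}}(\boldsymbol{t}_{\boldsymbol{m}})\,P_{\boldsymbol{m};i}(z;\boldsymbol{t}_{\boldsymbol{m}})=-i(i+1)\,P_{\boldsymbol{m};i}(z;\boldsymbol{t}_{\boldsymbol{m}}),\qquad i\in\mathbb{N}_0.$$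
   Context: $\mathbb{N}_0=\{0,1,2,\dots\}$. $D_z$ is the derivative in $z$, and subscripts $z$ denote derivatives. For a polynomial $\tau=\tau(z)$ define the operator $$\hat T(\tau)=(1-z^2)\Big(D_z^2-2\frac{\tau_z}{\tau}D_z+\frac{\tau_{zz}}{\tau}\Big)-2zD_z .$$ $\hat T(\tau)$ is called an exceptional Legendre operator if there exist (nonzero) polynomials $\{\hat P_i(z)\}_{i\in\mathbb{N}_0}$ and constants $\{\lambda_i\}_{i\in\mathbb{N}_0}$ such that $\hat T(\tau)\hat P_i=\lambda_i\hat P_i$ for all $i$, and such that the degree sequence $\{\deg\hat P_i\}_{i\in\mathbb{N}_0}$ misses only finitely many elements of $\mathbb{N}_0$ (it is not assumed that $\deg \hat P_i=i$). Classical Legendre polynomials: $P_i(z)=\frac{2^{-i}}{i!}D_z^i(z^2-1)^i$, $i\in\mathbb{N}_0$. For $i,j\in\mathbb{N}_0$ let $R_{ij}(z)=\int_{-1}^zP_i(u)P_j(u)\,du$. For an $n$-tuple $\boldsymbol{m}=(m_1,\dots,m_n)\in\mathbb{N}_0^n$ with associated real parameters $\boldsymbol{t}_{\boldsymbol{m}}=(t_{m_1},\dots,t_{m_n})\in\mathbb{R}^n$, let $\mathcal{R}_{\boldsymbol{m}}(z;\boldsymbol{t}_{\boldsymbol{m}})$ be the $n\times n$ matrix with polynomial entries $[\mathcal{R}_{\boldsymbol{m}}]_{k\ell}=\delta_{k\ell}+t_{m_\ell}R_{m_km_\ell}(z)$, let $\tau_{\boldsymbol{m}}(z;\boldsymbol{t}_{\boldsymbol{m}})=\det\mathcal{R}_{\boldsymbol{m}}(z;\boldsymbol{t}_{\boldsymbol{m}})$,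 and let $\boldsymbol{Q}_{\boldsymbol{m}}(z;\boldsymbol{t}_{\boldsymbol{m}})$ be the $n$-tuple of polynomials given by $$\boldsymbol{Q}_{\boldsymbol{m}}^{T}=\tau_{\boldsymbol{m}}\,\mathcal{R}_{\boldsymbol{m}}^{-1}\,(P_{m_1}(z),\dots,P_{m_n}(z))^{T}$$ (the inverse being taken over the rational functions in $z$; note $\tau_{\boldsymbol{m}}(-1)=1$). For $i\in\mathbb{N}_0$, with $(\boldsymbol{m},i)=(m_1,\dots,m_n,i)$ and $\boldsymbol{t}_{(\boldsymbol{m},i)}=(t_{m_1},\dots,t_{m_n},t_i)$, define $P_{\boldsymbol{m};i}(z;\boldsymbol{t}_{\boldsymbol{m}})=[\boldsymbol{Q}_{(\boldsymbol{m},i)}(z;\boldsymbol{t}_{(\boldsymbol{m},i)})]_{n+1}$, the last component; it does not depend on the last parameter $t_i$. *)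

(* Defs.v *)
From HB Require Import structures.
From mathcomp Require Import all_boot all_order all_algebra.
From mathcomp Require Import all_classical all_reals all_analysis.

Set Implicit Arguments.
Unset Strict Implicit.
Unset Printing Implicit Defensive.

Import Order.TTheory GRing.Theory Num.Theory.
Import numFieldNormedType.Exports.

Local Open Scope classical_set_scope.
Local Open Scope ring_scope.

Notation "p %:F" := (FracField.tofrac p) : ring_scope.

(* The operator \hat T(tau) acting on a polynomial; the result is a rational
   function because of the division by tau. *)
Definition hatT (R : realType) (tau y : {poly R}) : {fraction {poly R}} :=
  (1 - 'X^2)%:F * ((y^`(2))%:F - 2%:R * ((tau^`())%:F / tau%:F) * (y^`())%:F
                   + (tau^`(2))%:F / tau%:F * y%:F)
  - (2%:R *: 'X)%:F * (y^`())%:F.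

(* [tau != 0] is needed for \hat T(tau) to make sense; [(size p).-1] is the
   degree of a nonzero polynomial [p]. *)
Definition exceptional_Legendre (R : realType) (tau : {poly R}) : Prop :=
  tau != 0 /\
  exists (Phat : nat -> {poly R}) (lambda : nat -> R),
    [/\ forall i, Phat i != 0,
        forall i, hatT tau (Phat i) = (lambda i *: Phat i)%:F
      & finite_set (~` [set (size (Phat i)).-1 | i in [set: nat]])].

Definition Legendre (R : realType) (i : nat) : {poly R} :=
  (2%:R ^- i / (i`!)%:R) *: (('X^2 - 1) ^+ i)^`(i).

Definition antideriv (R : realType) (p : {poly R}) : {poly R} :=
  \poly_(k < (size p).+1) (p`_k.-1 / k%:R).

(* The polynomial z |-> \int_{-1}^z p(u) du; see [int_from_m1E]. *)
Definition int_from_m1 (R : realType) (p : {poly R}) : {poly R} :=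
  antideriv p - ((antideriv p).[-1])%:P.

Lemma deriv_int_from_m1 (R : realType) (p : {poly R}) :
  (int_from_m1 p)^`() = p.
Proof.
rewrite /int_from_m1 derivB derivC subr0; apply/polyP => k.
rewrite coef_deriv coef_poly /= ltnS.
case: ltnP => [_|/(nth_default 0) ->]; last by rewrite mul0rn.
by rewrite -[LHS]mulr_natr divfK // pnatr_eq0.
Qed.

Lemma horner_int_from_m1 (R : realType) (p : {poly R}) :
  (int_from_m1 p).[-1] = 0.
Proof. by rewrite /int_from_m1 hornerD hornerN hornerC subrr. Qed.

(* With [horner_int_from_m1], this covers \int_{-1}^z for z on either side
   of -1. *)
Lemma int_from_m1E (R : realType) (p : {poly R}) (a b : R) : a <= b ->
  (\int[lebesgue_measure]_(u in `[a, b]) p.[u])%R =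
  (int_from_m1 p).[b] - (int_from_m1 p).[a].
Proof.
rewrite le_eqVlt => /orP[/eqP <-|ab].
  by rewrite set_itv1 Rintegral_set1 subrr.
rewrite /Rintegral (@continuous_FTC2 _ _ (horner (int_from_m1 p))) //=.
- by apply: continuous_subspaceT => x; exact: continuous_horner.
- split=> [x _||]; first exact: derivable_horner.
  + by apply: cvg_at_right_filter; exact: continuous_horner.
  + by apply: cvg_at_left_filter; exact: continuous_horner.
- by move=> x _; rewrite -derivE deriv_int_from_m1.
Qed.

Definition Rpoly (R : realType) (i j : nat) : {poly R} :=
  int_from_m1 (Legendre R i * Legendre R j).

Definition Rmx (R : realType) (n : nat) (m : n.-tuple nat) (t : n.-tuple R) :
    'M[{poly R}]_n :=
  \matrix_(k, l) ((k == l)%:R + tnth t l *: Rpoly R (tnth m k) (tnth m l)).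

Definition tau (R : realType) (n : nat) (m : n.-tuple nat) (t : n.-tuple R) :
    {poly R} :=
  \det (Rmx m t).

Definition Legendre_col (R : realType) (n : nat) (m : n.-tuple nat) :
    'cV[{poly R}]_n :=
  \col_k Legendre R (tnth m k).

(* The adjugate is the polynomial form of [tau *: Rmx^-1]; see [Qcol_inv]. *)
Definition Qcol (R : realType) (n : nat) (m : n.-tuple nat) (t : n.-tuple R) :
    'cV[{poly R}]_n :=
  \adj (Rmx m t) *m Legendre_col R m.

(* The last parameter is irrelevant (see [Pexc_indep]) and is set to 0. *)
Definition Pexc (R : realType) (n : nat) (m : n.-tuple nat) (t : n.-tuple R)
    (i : nat) : {poly R} :=
  Qcol [tuple of rcons m i] [tuple of rcons t 0] ord_max 0.

Lemma tau_m1 (R : realType) (n : nat) (m : n.-tuple nat) (t : n.-tuple R) :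
  (tau m t).[-1] = 1.
Proof.
rewrite /tau -horner_evalE -det_map_mx (_ : map_mx _ _ = 1%:M) ?det1 //.
apply/matrixP => k l; rewrite !mxE /= /horner_eval hornerD hornerZ.
by rewrite horner_int_from_m1 mulr0 addr0 -polyC_natr hornerC.
Qed.

Lemma tau_neq0 (R : realType) (n : nat) (m : n.-tuple nat) (t : n.-tuple R) :
  tau m t != 0.
Proof.
apply/negP => /eqP t0; have := tau_m1 m t; rewrite t0 horner0 => /esym/eqP.
by rewrite oner_eq0.
Qed.

Lemma Qcol_inv (R : realType) (n : nat) (m : n.-tuple nat) (t : n.-tuple R) :
  let toF := @FracField.tofrac {poly R} in
  map_mx toF (Qcol m t) =
  toF (tau m t) *: (invmx (map_mx toF (Rmx m t))
                    *m map_mx toF (Legendre_col R m)).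
Proof.
move=> toF.
have d0 : toF (tau m t) != 0 by rewrite tofrac_eq0 tau_neq0.
rewrite /Qcol map_mxM map_mx_adj scalemxAl; congr (_ *m _).
by rewrite /invmx unitmxE det_map_mx unitfE d0 scalerA divff // scale1r.
Qed.

Lemma Pexc_indep (R : realType) (n : nat) (m : n.-tuple nat) (t : n.-tuple R)
    (i : nat) (s : R) :
  Qcol [tuple of rcons m i] [tuple of rcons t s] ord_max 0 = Pexc m t i.
Proof.
rewrite /Pexc /Qcol !mxE; apply: eq_bigr => k _; congr (_ * _).
rewrite !mxE /cofactor; congr (_ * \det _).
apply/matrixP => a b; rewrite !mxE; congr (_ + _ *: _).
rewrite !(tnth_nth 0) /= !nth_rcons size_tuple.
by have bn : (b < n)%N := ltn_ord b; rewrite /bump [(n <= b)%N]leqNgt bn add0n bn.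
Qed.

(* Main.v *)
Require Import Defs.
From HB Require Import structures.
From mathcomp Require Import all_boot all_order all_algebra.
From mathcomp Require Import all_classical all_reals all_analysis.
From mathcomp Require Import ring zify.

(** Write [T] for [tau m t], [P_i] for the Legendre polynomials, [R_ij] for
    [Rpoly R i j], [Q_l] for the entries of [Qcol m t], [s = 1 - z^2] and
    [la_i = i (i + 1)].

    Multiplying [hatT T y] by [T] gives the polynomial
    [H(y) = s (T y'' - 2 T' y' + T'' y) - 2 z T y'], which is bilinear in [T]
    and [y]; so the eigenvalue equation for [y_i = Pexc m t i] says that the
    defect [E_i = H(y_i) + la_i T y_i] vanishes.  Three facts give this.

    - Bordering the matrix [Rmx] shows
      [y_i = T P_i - sum_l t_l R_il Q_l]  ([PexcE]), and [y_(m_k) = Q_k].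
    - The derivative of [Rmx] has entries [t_l P_(m_k) P_(m_l)], so Jacobi's
      formula for the derivative of a determinant yields
      [T' = sum_l t_l P_(m_l) Q_l]  ([deriv_tau]).  Hence the terms with
      undifferentiated [Q_l] cancel in [y_i'], leaving
      [y_i' = T P_i' - sum_l t_l R_il Q_l'].
    - The Legendre equation and the Wronskian identity
      [(la_i - la_j) R_ij = s (P_i P_j' - P_i' P_j)]  ([Rpoly_Wronskian]).

    Substituting them into [H(y_i)], everything cancels except
    [E_i = - sum_l t_l R_il E_(m_l)]  ([defect_system]).  For [i = m_k] this is
    the homogeneous system with matrix [Rmx], whose determinant [T] is not
    zero; so each [E_(m_l)] vanishes, and then each [E_i].

    The degrees follow from the eigenvalue equation alone: with [N = deg T]
    and [d = deg y_i], comparing top coefficients gives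
    [(d - N) (d - N + 1) = i (i + 1)]  ([bilinT_degree]), that is [d = N + i]
    or [d = N - i - 1].  For [i >= N] only the first is possible, so every
    degree from [2 N] on is attained.  Finally [y_i] is not zero because its
    value at [-1] is that of [P_i]. *)

Set Implicit Arguments.
Unset Strict Implicit.
Unset Printing Implicit Defensive.

Import Order.TTheory GRing.Theory Num.Theory.
Local Open Scope ring_scope.

(** * Derivatives of products and determinants *)

Lemma deriv_prod (K : comNzRingType) (I : finType) (F : I -> {poly K}) :
  (\prod_i F i)^`() = \sum_i (F i)^`() * \prod_(j | j != i) F j.
Proof.
have H (s : seq I) : uniq s -> (\prod_(i <- s) F i)^`() =
    \sum_(i <- s) (F i)^`() * \prod_(j <- s | j != i) F j.
  elim: s => [|a s IH] /=; first by rewrite !big_nil derivC.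
  case/andP=> /negP nas us; rewrite !big_cons eqxx /= derivM IH //.
  congr (_ * _ + _).
    rewrite big_seq_cond [RHS]big_seq_cond; apply: eq_bigl => j.
    by case: (boolP (j \in s)) => //= js; case: eqP => // ja; rewrite -ja in nas.
  rewrite mulr_sumr big_seq [RHS]big_seq; apply: eq_bigr => i si.
  rewrite big_cons; case: eqP => [ai|_]; first by rewrite ai in nas.
  by rewrite mulrCA.
by rewrite H // index_enum_uniq.
Qed.

(** Jacobi's formula: the derivative of the Leibniz expansion differentiates one
    row at a time, and the determinant with row [i] differentiated is expanded
    along that row, where the cofactors are those of [A]. *)
Lemma deriv_det (K : comNzRingType) (n : nat) (A : 'M[{poly K}]_n) :
  (\det A)^`() = \sum_i \sum_j (A i j)^`() * cofactor A i j.
Proof.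
pose B i := \matrix_(k, j) (if k == i then (A k j)^`() else A k j).
transitivity (\sum_i \det (B i)).
  rewrite /determinant exchange_big raddf_sum /=; apply: eq_bigr => s _.
  rewrite -mulr_sumr.
  have -> : (-1) ^+ perm.odd_perm s = ((-1) ^+ perm.odd_perm s)%:P :> {poly K}.
    by rewrite rmorphXn rmorphN1.
  rewrite !mul_polyC derivZ deriv_prod; congr (_ *: _); apply: eq_bigr => i _.
  rewrite [RHS](bigD1 i) //= mxE eqxx; congr (_ * _); apply: eq_bigr => j ji.
  by rewrite mxE (negbTE ji).
apply: eq_bigr => i _; rewrite (expand_det_row _ i); apply: eq_bigr => j _.
rewrite mxE eqxx; congr (_ * _); rewrite /cofactor; congr (_ * \det _).
by apply/matrixP => a b; rewrite !mxE eq_sym (negbTE (neq_lift _ _)).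
Qed.

(** Of the Leibniz terms, only the one that differentiates the power all [k]
    times survives at the root; the induction peels off one derivative and
    absorbs it into the cofactor [g]. *)
Lemma derivn_root_exp (K : comNzRingType) (a : K) (k : nat) (g : {poly K}) :
  (g * ('X - a%:P) ^+ k)^`(k).[a] = g.[a] *+ k`!.
Proof.
elim: k g => [|k IH] g; first by rewrite derivn0 expr0 mulr1.
rewrite derivSn derivM deriv_exp derivXsubC mul1r -pred_Sn.
have -> : g^`() * ('X - a%:P) ^+ k.+1 + g * (('X - a%:P) ^+ k *+ k.+1)
   = (g^`() * ('X - a%:P) + g *+ k.+1) * ('X - a%:P) ^+ k.
  by rewrite exprS; ring.
by rewrite IH !hornerE subrr mulr0 add0r hornerMn -mulrnA factS.
Qed.

(** * Legendre polynomials *)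

(** This is the [k.+1]-st derivative of the first order equation
    [(z^2 - 1) f' = 2 i z f] satisfied by [f = (z^2 - 1)^i]; at [k = i] it is
    the Legendre equation. *)
Lemma Rodrigues_ode (K : comNzRingType) (i k : nat)
    (f := ('X^2 - 1) ^+ i : {poly K}) :
  ('X^2 - 1) * f^`(k.+2) + (2 * k.+1%:R - 2 * i%:R) *: ('X * f^`(k.+1))
   + (k%:R * k.+1%:R - 2 * i%:R * k.+1%:R) *: f^`(k) = 0.
Proof.
have f1 : ('X^2 - 1) * f^`() - (2 * i%:R) *: ('X * f) = 0.
  rewrite /f; case: i {f} => [|i].
    by rewrite expr0 derivC !mulr0 scale0r subr0.
  rewrite deriv_exp derivB derivC derivXn /= -mul_polyC (exprS _ i).
  rewrite ?(polyCM, polyC_natr); ring.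
elim: k => [|k IH].
  move: (congr1 (@deriv _) f1).
  rewrite derivB derivM derivZ derivM derivB derivXn derivX !derivC /= => E.
  rewrite -[RHS]E -!mul_polyC
    ?(polyCM, polyCD, polyCB, polyCN, polyC_natr, polyC1).
  ring.
move: (congr1 (@deriv _) IH).
rewrite !derivD derivM !derivZ derivM derivB derivXn derivX !derivC /= => E.
rewrite -[RHS]E -!mul_polyC -!derivnS -(natr1 k.+1)
  ?(polyCM, polyCD, polyCB, polyCN, polyC_natr, polyC1).
ring.
Qed.

Lemma Legendre_ode (R : realType) (i : nat) :
  (1 - 'X^2) * (Legendre R i)^`(2) - 2%:R *: ('X * (Legendre R i)^`())
  = - (i%:R * (i%:R + 1)) *: Legendre R i.
Proof.
have := Rodrigues_ode R i i; rewrite /Legendre.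
set f := ('X^2 - 1) ^+ i; set c := _ / _ => E.
rewrite !derivnS derivn0 in E *; rewrite !derivZ.
rewrite -[RHS]addr0 -[X in _ = _ + X](scaler0 _ (- c)) -E.
rewrite -!mul_polyC -(natr1 i)
  ?(polyCM, polyCD, polyCB, polyCN, polyC_natr, polyC1).
ring.
Qed.

(** Near [-1] the Rodrigues polynomial is [(z - 1)^i (z + 1)^i], so
    [derivn_root_exp] evaluates its [i]-th derivative there. *)
Lemma Legendre_m1_neq0 (R : realType) (i : nat) : (Legendre R i).[-1] != 0.
Proof.
rewrite /Legendre hornerZ.
have -> : ('X^2 - 1 : {poly R}) ^+ i = ('X - 1%:P) ^+ i * ('X - (-1)%:P) ^+ i.
  rewrite -exprMn; congr (_ ^+ _); rewrite polyCN polyC1; ring.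
rewrite derivn_root_exp horner_exp hornerXsubC -opprD.
have nz k : k`!%:R != 0 :> R by rewrite pnatr_eq0 -lt0n fact_gt0.
have n2 : 2 != 0 :> R by rewrite pnatr_eq0.
apply: mulf_neq0; first by rewrite mulf_neq0 ?invr_eq0 ?expf_neq0.
by rewrite -[X in X != _]mulr_natr mulf_neq0 ?expf_neq0 ?oppr_eq0.
Qed.

Lemma poly_eq_of_deriv (R : realType) (a : R) (p q : {poly R}) :
  p^`() = q^`() -> p.[a] = q.[a] -> p = q.
Proof.
move=> d h; apply/eqP; rewrite -subr_eq0; apply/eqP.
have d0 : (p - q)^`() = 0 by rewrite derivB d subrr.
have c : p - q = ((p - q)`_0)%:P.
  apply/polyP => -[|k]; rewrite coefC //=; apply/eqP.
  have := congr1 (fun r : {poly R} => r`_k) d0; rewrite coef_deriv coef0 => /eqP.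
  by rewrite mulrn_eq0.
have := h; move/eqP; rewrite -subr_eq0 -hornerN -hornerD c hornerC => /eqP ->.
by rewrite polyC0.
Qed.

(** Both sides vanish at [-1], and by the Legendre equation, in the self-adjoint
    form [(s P')' = - la P], they have the same derivative. *)
Lemma Rpoly_Wronskian (R : realType) (i j : nat) :
  (i%:R * (i%:R + 1) - j%:R * (j%:R + 1)) *: Rpoly R i j
  = (1 - 'X^2) * (Legendre R i * (Legendre R j)^`()
                  - (Legendre R i)^`() * Legendre R j).
Proof.
apply: (@poly_eq_of_deriv R (-1)); last first.
  by rewrite hornerZ horner_int_from_m1 mulr0 !hornerE sqrrN expr1n subrr mul0r.
rewrite derivZ deriv_int_from_m1 !derivM !derivB !derivM derivC derivX.
have := Legendre_ode R i; have := Legendre_ode R j.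
rewrite !derivnS !derivn0.
set P := Legendre R i; set Q := Legendre R j => EQ EP.
transitivity (P * (- (j%:R * (j%:R + 1)) *: Q)
              - Q * (- (i%:R * (i%:R + 1)) *: P)).
  rewrite -!mul_polyC
    ?(polyCM, polyCD, polyCB, polyCN, polyC_natr, polyC1).
  ring.
rewrite -EQ -EP -!mul_polyC
  ?(polyCM, polyCD, polyCB, polyCN, polyC_natr, polyC1).
ring.
Qed.

(** * The matrix of integrals and its determinant *)

Lemma Rmx_mulE (R : realType) (n : nat) (m : n.-tuple nat) (t : n.-tuple R)
    (c : 'cV[{poly R}]_n) (k : 'I_n) :
  (Rmx m t *m c) k 0 =
  c k 0 + \sum_l tnth t l *: Rpoly R (tnth m k) (tnth m l) * c l 0.
Proof.
transitivity (\sum_l ((k == l)%:R * c l 0 +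
    tnth t l *: Rpoly R (tnth m k) (tnth m l) * c l 0)).
  by rewrite mxE; apply: eq_bigr => l _; rewrite [Rmx m t k l]mxE mulrDl.
rewrite big_split /= (bigD1 k) //= eqxx mul1r big1 ?addr0 // => l lk.
by rewrite eq_sym (negbTE lk) mul0r.
Qed.

Lemma Rmx_Qcol (R : realType) (n : nat) (m : n.-tuple nat) (t : n.-tuple R)
    (k : 'I_n) :
  Qcol m t k 0 + \sum_l tnth t l *: Rpoly R (tnth m k) (tnth m l) * Qcol m t l 0
  = tau m t * Legendre R (tnth m k).
Proof.
rewrite -Rmx_mulE /Qcol mulmxA mul_mx_adj mul_scalar_mx mxE.
by congr (_ * _); rewrite mxE.
Qed.

(** A homogeneous linear system over [{poly R}] with matrix [Rmx m t] has only
    the trivial solution, because multiplying by the adjugate turns it into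
    multiplication by [tau m t]. *)
Lemma Rmx_injective (R : realType) (n : nat) (m : n.-tuple nat)
    (t : n.-tuple R) (c : 'I_n -> {poly R}) :
  (forall k, c k + \sum_l tnth t l *: Rpoly R (tnth m k) (tnth m l) * c l = 0) ->
  forall k, c k = 0.
Proof.
move=> H k; pose C := \col_l c l.
have MC : Rmx m t *m C = 0.
  apply/matrixP => a b; rewrite ord1 Rmx_mulE [RHS]mxE -[RHS](H a) mxE.
  by congr (_ + _); apply: eq_bigr => l _; rewrite mxE.
have : (tau m t)%:M *m C = 0 by rewrite -mul_adj_mx -mulmxA MC mulmx0.
rewrite mul_scalar_mx => /matrixP/(_ k 0); rewrite !mxE => /eqP.
by rewrite mulf_eq0 (negbTE (tau_neq0 m t)) => /eqP.
Qed.

(** [Rmx] differentiates to a matrix of rank at most one, so Jacobi's formula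
    collapses to a pairing with the adjugate applied to the Legendre column. *)
Lemma deriv_tau (R : realType) (n : nat) (m : n.-tuple nat) (t : n.-tuple R) :
  (tau m t)^`() = \sum_l tnth t l *: Legendre R (tnth m l) * Qcol m t l 0.
Proof.
rewrite /tau deriv_det exchange_big /=; apply: eq_bigr => l _.
rewrite /Qcol mxE mulr_sumr; apply: eq_bigr => k _.
rewrite !mxE derivD -polyC_natr derivC add0r derivZ deriv_int_from_m1.
by rewrite -!mul_polyC; ring.
Qed.

(** With last parameter [0], the bordered matrix has last column
    [(0, ..., 0, 1)], so it has the same determinant [tau m t], and the upper
    rows of its system are the system that determines [Qcol m t]; the last row
    then reads off the last component. *)
Lemma PexcE (R : realType) (n : nat) (m : n.-tuple nat) (t : n.-tuple R)
    (i : nat) :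
  Pexc m t i = tau m t * Legendre R i
    - \sum_l tnth t l *: Rpoly R i (tnth m l) * Qcol m t l 0.
Proof.
set m' := [tuple of rcons m i]; set t' := [tuple of rcons t 0].
have mw (l : 'I_n) : tnth m' (widen_ord (leqnSn n) l) = tnth m l.
  by rewrite !(tnth_nth 0%N) /= nth_rcons size_tuple ltn_ord.
have tw (l : 'I_n) : tnth t' (widen_ord (leqnSn n) l) = tnth t l.
  by rewrite !(tnth_nth 0) /= nth_rcons size_tuple ltn_ord.
have mM : tnth m' ord_max = i.
  by rewrite (tnth_nth 0%N) /= nth_rcons size_tuple ltnn eqxx.
have tM : tnth t' ord_max = 0.
  by rewrite (tnth_nth 0) /= nth_rcons size_tuple ltnn eqxx.
have tau' : tau m' t' = tau m t.
  rewrite /tau (expand_det_col _ ord_max) big_ord_recr /= big1 => [|l _].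
    rewrite add0r mxE eqxx tM scale0r addr0 mul1r /cofactor addnn -signr_odd.
    rewrite odd_double mul1r; congr (\det _); apply/matrixP => a b.
    rewrite !mxE (inj_eq lift_inj).
    have lw (c : 'I_n) : lift ord_max c = widen_ord (leqnSn n) c.
      by apply: val_inj; exact: lift_max.
    by rewrite !lw !mw tw.
  rewrite mxE tM scale0r addr0 -val_eqE /= ltn_eqF ?ltn_ord ?mul0r //.
have E (k : 'I_n.+1) := Rmx_Qcol m' t' k.
have Q' l : Qcol m' t' (widen_ord (leqnSn n) l) 0 = Qcol m t l 0.
  apply/eqP; rewrite -subr_eq0; apply/eqP; move: l.
  apply: (@Rmx_injective R n m t) => k.
  have := E (widen_ord (leqnSn n) k).
  rewrite big_ord_recr /= tM scale0r mul0r addr0 mw tau' -(Rmx_Qcol m t k).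
  move/eqP; rewrite -subr_eq0 => /eqP e; rewrite -[RHS]e opprD addrACA.
  congr (_ + _); rewrite -sumrB; apply: eq_bigr => l _.
  by rewrite mw tw mulrBr.
have := E ord_max; rewrite big_ord_recr /= tM scale0r mul0r addr0 mM tau' => <-.
rewrite /Pexc -/m' -/t'.
rewrite (eq_bigr (fun l => tnth t l *: Rpoly R i (tnth m l) * Qcol m t l 0)).
  by rewrite addrK.
by move=> l _; rewrite mw tw Q'.
Qed.

Lemma Pexc_mem (R : realType) (n : nat) (m : n.-tuple nat) (t : n.-tuple R)
    (k : 'I_n) :
  Pexc m t (tnth m k) = Qcol m t k 0.
Proof. by rewrite PexcE -Rmx_Qcol addrK. Qed.

(** * The eigenvalue equation *)

(** The operator [hatT tau] with its denominator cleared, that is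
    [tau * hatT tau y]. *)
Definition bilinT (K : comNzRingType) (tau y : {poly K}) : {poly K} :=
  (1 - 'X^2) * (tau * y^`(2) - 2%:R * (tau^`() * y^`()) + tau^`(2) * y)
  - 2%:R *: 'X * (tau * y^`()).

(** It vanishes exactly when [Pexc m t i] satisfies the eigenvalue equation. *)
Definition defect (R : realType) (n : nat) (m : n.-tuple nat)
    (t : n.-tuple R) (i : nat) : {poly R} :=
  bilinT (tau m t) (Pexc m t i)
    + (i%:R * (i%:R + 1)) *: (tau m t * Pexc m t i).

(** The defects satisfy the homogeneous form of the system that expresses
    [Pexc m t i] through the [Qcol m t]: the terms with [P_i] cancel by the
    Legendre equation, and the mismatch of the eigenvalues inside the sum is
    compensated by the Wronskian identity. *)
Lemma defect_system (R : realType) (n : nat) (m : n.-tuple nat)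
    (t : n.-tuple R) (i : nat) :
  defect m t i
  + \sum_l tnth t l *: Rpoly R i (tnth m l) * defect m t (tnth m l) = 0.
Proof.
pose P := Legendre R; pose T := tau m t; pose Q l := Qcol m t l 0.
pose p l := P (tnth m l); pose r l := Rpoly R i (tnth m l).
have dr l : (r l)^`() = P i * p l by rewrite deriv_int_from_m1.
pose S (f g : 'I_n -> {poly R}) := \sum_l tnth t l *: f l * g l.
have dS f g : (S f g)^`() = S (fun l => (f l)^`()) g + S f (fun l => (g l)^`()).
  rewrite /S raddf_sum -big_split; apply: eq_bigr => l _ /=.
  by rewrite derivM derivZ.
have SM f g h : S (fun l => h * f l) g = h * S f g.
  rewrite /S mulr_sumr; apply: eq_bigr => l _; rewrite -!mul_polyC; ring.
have T1 : T^`() = S p Q by exact: deriv_tau.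
have yE : Pexc m t i = T * P i - S r Q by exact: PexcE.
pose Q1 l := (Q l)^`(); pose Q2 l := (Q1 l)^`().
have y1 : (Pexc m t i)^`() = T * (P i)^`() - S r Q1.
  rewrite yE derivB derivM dS.
  rewrite [S (fun l => (r l)^`()) Q](_ : _ = P i * S p Q); last first.
    by rewrite -SM; apply: eq_bigr => l _; rewrite dr.
  by rewrite T1; ring.
have y2 : (Pexc m t i)^`()^`() =
    T^`() * (P i)^`() + T * (P i)^`()^`() - P i * S p Q1 - S r Q2.
  rewrite y1 derivB derivM dS.
  rewrite [S (fun l => (r l)^`()) Q1](_ : _ = P i * S p Q1); last first.
    by rewrite -SM; apply: eq_bigr => l _; rewrite dr.
  by ring.
pose p1 l := (p l)^`().
have T2 : T^`()^`() = S p1 Q + S p Q1 by rewrite T1 dS.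
pose la k : R := k%:R * (k%:R + 1).
(* The sum over [l] of the Wronskian identities for [i] and [m_l]. *)
have W : S (fun l => (la i - la (tnth m l)) *: r l) Q
   = (1 - 'X^2) * (P i * S p1 Q - (P i)^`() * S p Q).
  rewrite /S !mulr_sumr -sumrB mulr_sumr; apply: eq_bigr => l _.
  rewrite /r Rpoly_Wronskian -/P -/(p l) -!mul_polyC /p1; ring.
(* The sum of the defects is [bilinT T] applied to [sum_l t_l R_il Q_l] with the
   [R_il] treated as constants, plus the eigenvalue terms; writing these
   with [la i] exposes the sum computed by [W]. *)
have -> : \sum_l tnth t l *: Rpoly R i (tnth m l) * defect m t (tnth m l) =
  (1 - 'X^2) * (T * S r Q2 - 2%:R * (T^`() * S r Q1) + T^`(2) * S r Q)
  - 2%:R *: 'X * (T * S r Q1)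
  + T * ((la i)%:P * S r Q - S (fun l => (la i - la (tnth m l)) *: r l) Q).
  have -> : (la i)%:P * S r Q - S (fun l => (la i - la (tnth m l)) *: r l) Q
    = \sum_l (la (tnth m l))%:P * (tnth t l *: r l * Q l).
    rewrite /S mulr_sumr -sumrB; apply: eq_bigr => l _.
    rewrite -!mul_polyC polyCB; ring.
  rewrite /S !(mulrDr, mulrN) !mulr_sumr -!sumrN -!big_split /=.
  apply: eq_bigr => l _; rewrite /defect Pexc_mem /bilinT.
  rewrite -/(r l) -/(Q l) -/(la _) /Q2 /Q1 -/T !derivnS !derivn0 -!mul_polyC.
  ring.
rewrite /defect /bilinT !derivnS !derivn0 -/T y2 y1 yE W T2 T1 -/(la i).
have ode := Legendre_ode R i.
rewrite !derivnS !derivn0 -/P -/(la i) in ode.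
transitivity (T * T * (((1 - 'X^2) * (P i)^`()^`() - 2%:R *: ('X * (P i)^`()))
   - (- la i *: P i))).
  rewrite -!mul_polyC polyCN; ring.
by rewrite ode subrr mulr0.
Qed.

(** The defects with index in [m] solve a nonsingular homogeneous system, hence
    vanish; every other defect is a combination of these. *)
Lemma bilinT_Pexc (R : realType) (n : nat) (m : n.-tuple nat)
    (t : n.-tuple R) (i : nat) :
  bilinT (tau m t) (Pexc m t i)
  = - (i%:R * (i%:R + 1)) *: (tau m t * Pexc m t i).
Proof.
have H := defect_system m t.
have Z := Rmx_injective (fun k => H (tnth m k)).
have := H i; rewrite big1 => [|l _]; last by rewrite Z mulr0.
by rewrite addr0 => /eqP; rewrite addr_eq0 -scaleNr => /eqP.
Qed.

Lemma hatT_bilinT (R : realType) (tau y : {poly R}) (c : R) : tau != 0 ->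
  bilinT tau y = c *: (tau * y) -> hatT tau y = (c *: y)%:F.
Proof.
move=> t0 H; have tF : tau%:F != 0 by rewrite tofrac_eq0.
apply: (mulfI tF).
have -> : tau%:F * (c *: y)%:F = (bilinT tau y)%:F.
  by rewrite H -tofracM scalerAr.
rewrite /bilinT /hatT !(tofracM, tofracB, tofracD, tofrac1).
(* Stated over an arbitrary field so that the normalisation does not unfold the
   construction of the fraction field. *)
have cancel (F : fieldType) (s z a a1 a2 b b1 b2 : F) : a != 0 ->
    a * (s * (b2 - 2%:R * (a1 / a) * b1 + a2 / a * b) - z * b1)
    = s * (a * b2 - (1 + 1) * (a1 * b1) + a2 * b) - z * (a * b1).
  by move=> a0; field.
exact: cancel.
Qed.

(** * Degrees *)

(** The size bounds need not be attained: a factor of smaller degree just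
    contributes a zero coefficient.  Thus a single rule computes the top
    coefficient of every term of [bilinT]. *)
Lemma coefM_top (K : nzRingType) (p q : {poly K}) (a b : nat) :
  (size p <= a.+1)%N -> (size q <= b.+1)%N ->
  (p * q)`_(a + b) = p`_a * q`_b.
Proof.
move=> pa qb; have lt : (a < (a + b).+1)%N by rewrite ltnS leq_addr.
rewrite coefM (bigD1 (Ordinal lt)) //= addKn big1 ?addr0 // => j ja.
case: (ltngtP j a) => [lja|laj|eja].
- by rewrite (nth_default 0 (s := q)) ?mulr0 // (leq_trans qb) //; lia.
- by rewrite (nth_default 0 (s := p)) ?mul0r // (leq_trans pa).
- by rewrite -val_eqE /= eja eqxx in ja.
Qed.

(** The operator [z d/dz] is diagonal on monomials, so it does not raise the
    degree and keeps track of top coefficients. *)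
Definition euler (K : nzRingType) (p : {poly K}) : {poly K} := 'X * p^`().

Lemma coef_euler (K : nzRingType) (p : {poly K}) (k : nat) :
  (euler p)`_k = p`_k *+ k.
Proof. by rewrite coefXM; case: k => [|k] //=; rewrite coef_deriv. Qed.

Lemma size_euler (K : nzRingType) (p : {poly K}) : (size (euler p) <= size p)%N.
Proof.
by apply/leq_sizeP => k pk; rewrite coef_euler nth_default // mul0rn.
Qed.

Lemma size_deriv_le (K : nzRingType) (p : {poly K}) : (size p^`() <= size p)%N.
Proof.
apply/leq_sizeP => k pk.
by rewrite coef_deriv nth_default ?mul0rn // (leq_trans pk).
Qed.

(** The indicial equation at infinity: it compares the coefficients of degree
    [N + d] on both sides of the eigenvalue equation. *)
Lemma bilinT_degree (K : idomainType) (tau y : {poly K}) (c : K)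
    (N d : nat) : size tau = N.+1 -> size y = d.+1 ->
  bilinT tau y = c *: (tau * y) ->
  (d%:R - N%:R) * (d%:R - N%:R + 1) = - c.
Proof.
move=> sN sd H.
(* Every power of [z] is absorbed into a power of [euler]; note that
   [z^2 p'' = euler (euler p) - euler p]. *)
have e : bilinT tau y = tau * y^`()^`() - tau * (euler (euler y) - euler y)
    - 2%:R * (tau^`() * y^`()) + 2%:R * (euler tau * euler y)
    + tau^`()^`() * y - (euler (euler tau) - euler tau) * y
    - 2%:R * (tau * euler y).
  rewrite /bilinT /euler !derivM !derivX !derivnS !derivn0 -mul_polyC polyC_natr.
  by ring.
have S1 (p : {poly K}) r := leq_trans (size_deriv_le p) r.
have S2 (p : {poly K}) r := leq_trans (size_euler p) r.
have S3 (p q : {poly K}) k : (size p <= k)%N -> (size q <= k)%N ->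
    (size (p - q)%R <= k)%N.
  by move=> pk qk; rewrite (leq_trans (size_polyD _ _)) // size_polyN geq_max pk.
have St : (size tau <= N.+1)%N by rewrite sN.
have Sy : (size y <= d.+1)%N by rewrite sd.
have z (p : {poly K}) k : (size p <= k.+1)%N -> p^`()`_k = 0.
  by move=> pk; rewrite coef_deriv nth_default ?mul0rn.
move: (congr1 (fun p : {poly K} => p`_(N + d)) H).
rewrite e -!mul_polyC -!polyC_natr !(coefD, coefN, coefCM).
rewrite !coefM_top ?(S3, S1, S2) //.
rewrite !(coefD, coefN, coef_euler) !z ?S1 //.
set a := tau`_N; set b := y`_d => E.
have a0 : a != 0
  by rewrite /a -[N]/(N.+1.-1) -sN -/(lead_coef tau) lead_coef_eq0
    -size_poly_eq0 sN.
have b0 : b != 0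
  by rewrite /b -[d]/(d.+1.-1) -sd -/(lead_coef y) lead_coef_eq0
    -size_poly_eq0 sd.
apply: (mulfI a0); apply: (mulfI b0).
transitivity (- (c * (a * b))); last by ring.
by rewrite -E; ring.
Qed.

(** At [-1] the integrals [Rpoly] vanish and [tau] is [1], so [Pexc m t i] takes
    there the value of the Legendre polynomial. *)
Lemma Pexc_neq0 (R : realType) (n : nat) (m : n.-tuple nat) (t : n.-tuple R)
    (i : nat) : Pexc m t i != 0.
Proof.
apply/eqP => y0; have := Legendre_m1_neq0 R i.
have := congr1 (horner^~ (-1)) y0; rewrite PexcE horner0 hornerD hornerN.
rewrite hornerM tau_m1 mul1r horner_sum big1 => [|l _].
  by rewrite subr0 => -> /eqP.
by rewrite hornerM hornerZ horner_int_from_m1 mulr0 mul0r.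
Qed.

(** The indicial equation factors as [(d - N - i) (d - N + i + 1) = 0]; its other
    root [d = N - i - 1] is negative when [N <= i]. *)
Lemma degree_Pexc (R : realType) (n : nat) (m : n.-tuple nat)
    (t : n.-tuple R) (i : nat) : ((size (tau m t)).-1 <= i)%N ->
  (size (Pexc m t i)).-1 = ((size (tau m t)).-1 + i)%N.
Proof.
have pos (p : {poly R}) : p != 0 -> size p = (size p).-1.+1.
  by move=> p0; rewrite prednK // size_poly_gt0.
have := bilinT_degree (pos _ (tau_neq0 m t)) (pos _ (Pexc_neq0 m t i))
  (bilinT_Pexc m t i).
move: (size (tau m t)).-1 (size (Pexc m t i)).-1 => N d E Ni.
have : (d%:R - (N + i)%:R) * ((d + i.+1)%:R - N%:R) = 0 :> R.
  rewrite !natrD -natr1.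
  transitivity ((d%:R - N%:R) * (d%:R - N%:R + 1) - i%:R * (i%:R + 1) : R).
    by ring.
  by rewrite E; ring.
move/eqP; rewrite mulf_eq0 !subr_eq0 !eqr_nat => /orP[/eqP //|/eqP].
lia.
Qed.

(** * The exceptional Legendre operators *)

Theorem theorem1p5 (R : realType) (n : nat) (m : n.-tuple nat)
    (t : n.-tuple R) (hn : (1 <= n)%N) :
  exceptional_Legendre (tau m t) /\
  forall i : nat,
    hatT (tau m t) (Pexc m t i) = ((- (i%:R * (i%:R + 1))) *: Pexc m t i)%:F.
Proof.
have eigen i := hatT_bilinT (tau_neq0 m t) (bilinT_Pexc m t i).
split=> //; split; first exact: tau_neq0.
exists (Pexc m t), (fun i => - (i%:R * (i%:R + 1))); split=> //.
  by move=> i; exact: Pexc_neq0.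
set N := (size (tau m t)).-1.
apply: (@sub_finite_set _ _ `I_(N + N)); last exact: finite_II.
move=> k /= kP; rewrite ltnNge; apply/negP => Nk; apply: kP.
exists (k - N)%N => //; rewrite degree_Pexc -/N; lia.
Qed.
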